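(* Let $R$ be one of the following complex Lie algebras (each with basis consisting of the basis $e_1,\dots,e_m$ of the indicated nilpotent Lie algebra plus one element $x$, brackets among the $e_i$ as in that nilpotent algebra, and brackets with $x$ as listed, all others zero): $R(g^3_{(n,1)},1)$ ($n\ge7$): $[e_1,x]=-[x,e_1]=e_1$, $[e_i,x]=-[x,e_i]=(i+1)e_i$ ($2\le i\le n-1$), $[e_n,x]=-[x,e_n]=2e_n$; $R(g^1_7,1)$: $[e_i,x]=-[x,e_i]=ie_i$ ($1\le i\le 7$); $R(g^2_9,1)$: $[e_i,x]=-[x,e_i]=ie_i$ ($1\le i\le 9$); $R(g^3_{11},1)$: $[e_i,x]=-[x,e_i]=ie_i$ ($1\le i\le 11$). Then $\dim H^2(R,R)=1$.
   Context: $H^2(R,R)$ is the second Chevalley–Eilenberg cohomology of the Lie algebra $R$ with adjoint coefficients. The nilpotent Lie algebras (only listed brackets and their antisymmetric counterparts nonzero): $g^3_{(n,1)}$ ($n\ge7$): $[e_1,e_i]=e_{i+1}$ ($2\le i\le n-2$); $[e_i,e_n]=e_{i+2}$ ($2\le i\le n-3$); $[e_2,e_i]=e_{i+3}$ ($3\le i\le n-4$). $g^1_7$: $[e_1,e_i]=e_{i+1}$ ($2\le i\le 5$); $[e_2,e_i]=e_{i+2}$ ($3\le i\le 4$); $[e_i,e_{7-i}]=(-1)^ie_7$ ($2\le i\le 3$). $g^2_9$: $[e_1,e_i]=e_{i+1}$ ($2\le i\le 7$); $[e_2,e_i]=e_{i+2}$ ($3\le i\le 4$); $[e_2,e_5]=3e_7$;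 $[e_2,e_6]=5e_8$; $[e_3,e_i]=-2e_{i+3}$ ($4\le i\le5$); $[e_i,e_{9-i}]=(-1)^ie_9$ ($2\le i\le 4$). $g^3_{11}$: $[e_1,e_i]=e_{i+1}$ ($2\le i\le 9$); $[e_2,e_i]=e_{i+2}$ ($3\le i\le 4$); $[e_2,e_i]=-e_{i+2}$ ($6\le i\le 7$); $[e_3,e_7]=-e_{10}$; $[e_3,e_i]=e_{i+3}$ ($4\le i\le 5$); $[e_4,e_i]=e_{i+4}$ ($5\le i\le 6$); $[e_i,e_{11-i}]=(-1)^ie_{11}$ ($2\le i\le 5$). *)

(* Defs.v *)
From HB Require Import structures.
From mathcomp Require Import all_boot all_order all_algebra.
From mathcomp Require Import reals Rstruct complex.
Set Implicit Arguments. Unset Strict Implicit. Unset Printing Implicit Defensive.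
Import Order.TTheory GRing.Theory Num.Theory.
Local Open Scope ring_scope.

Section CE.
Variables (F : fieldType) (N : nat).
Local Notation V := 'rV[F]_N.
(* bracket table: bt i j = [e_i, e_j] *)
Variable bt : 'I_N -> 'I_N -> V.

Definition ebas (i : 'I_N) : V := delta_mx 0 i.

Definition lbr (x y : V) : V := \sum_i \sum_j (x 0 i * y 0 j) *: bt i j.

(* cochains, determined by their values on basis (tuples of) vectors *)
Definition C1 := {ffun 'I_N -> V}.
Definition C2 := {ffun 'I_N * 'I_N -> V}.
Definition C3 := {ffun 'I_N * 'I_N * 'I_N -> V}.

Definition ev1 (psi : C1) (x : V) : V := \sum_i x 0 i *: psi i.
Definition ev2 (phi : C2) (x y : V) : V :=
  \sum_i \sum_j (x 0 i * y 0 j) *: phi (i, j).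

Definition altdefect (phi : C2) : C2 :=
  [ffun p => if p.1 == p.2 then phi p else phi p + phi (p.2, p.1)].

Definition d1 (psi : C1) : C2 :=
  [ffun p => lbr (ebas p.1) (psi p.2) - lbr (ebas p.2) (psi p.1)
             - ev1 psi (bt p.1 p.2)].

Definition d2 (phi : C2) : C3 :=
  [ffun t => let: (i, j, k) := t in
     lbr (ebas i) (phi (j, k)) - lbr (ebas j) (phi (i, k))
     + lbr (ebas k) (phi (i, j))
     - ev2 phi (bt i j) (ebas k) + ev2 phi (bt i k) (ebas j)
     - ev2 phi (bt j k) (ebas i)].

Definition Alt2 : {vspace C2} := lker (linfun altdefect).
Definition Z2 : {vspace C2} := (Alt2 :&: lker (linfun d2))%VS.
Definition B2 : {vspace C2} := limg (linfun d1).

(* dim H^2(L,L) = dim (Z^2 / B^2) = dim Z^2 - dim B^2  (B^2 <= Z^2) *)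
Definition dimH2 : nat := (\dim Z2 - \dim B2)%N.
End CE.

(* Bracket tables given on 1-based labels a < b:
   f a b = (c, k) means [e_a, e_b] = c e_k  (c = 0 : bracket zero).
   The table is extended antisymmetrically; [e_a, e_a] = 0. *)
Definition table (F : fieldType) (N : nat) (f : nat -> nat -> int * nat)
  (i j : 'I_N) : 'rV[F]_N :=
  if (i < j)%N then
    \row_k (if (k.+1 == (f i.+1 j.+1).2)%N then ((f i.+1 j.+1).1)%:~R else 0)
  else if (j < i)%N then
    - \row_k (if (k.+1 == (f j.+1 i.+1).2)%N then ((f j.+1 i.+1).1)%:~R else 0)
  else 0.

Definition g3n1 (n a b : nat) : int * nat :=
  if (a == 1)%N && (2 <= b <= n - 2)%N then (1%:Z, b.+1)
  else if (2 <= a <= n - 3)%N && (b == n) then (1%:Z, a + 2)%N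
  else if (a == 2)%N && (3 <= b <= n - 4)%N then (1%:Z, b + 3)%N
  else (0%:Z, 0%N).

Definition g17 (a b : nat) : int * nat :=
  if (a == 1)%N && (2 <= b <= 5)%N then (1%:Z, b.+1)
  else if (a == 2)%N && (3 <= b <= 4)%N then (1%:Z, b + 2)%N
  else if (2 <= a <= 3)%N && (b == 7 - a)%N then (((-1) ^+ a)%R, 7%N)
  else (0%:Z, 0%N).

Definition g29 (a b : nat) : int * nat :=
  if (a == 1)%N && (2 <= b <= 7)%N then (1%:Z, b.+1)
  else if (a == 2)%N && (3 <= b <= 4)%N then (1%:Z, b + 2)%N
  else if (a == 2)%N && (b == 5)%N then (3%:Z, 7%N)
  else if (a == 2)%N && (b == 6)%N then (5%:Z, 8%N)
  else if (a == 3)%N && (4 <= b <= 5)%N then ((-2)%R, b + 3)%N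
  else if (2 <= a <= 4)%N && (b == 9 - a)%N then (((-1) ^+ a)%R, 9%N)
  else (0%:Z, 0%N).

Definition g311 (a b : nat) : int * nat :=
  if (a == 1)%N && (2 <= b <= 9)%N then (1%:Z, b.+1)
  else if (a == 2)%N && (3 <= b <= 4)%N then (1%:Z, b + 2)%N
  else if (a == 2)%N && (6 <= b <= 7)%N then ((-1)%R, b + 2)%N
  else if (a == 3)%N && (b == 7)%N then ((-1)%R, 10%N)
  else if (a == 3)%N && (4 <= b <= 5)%N then (1%:Z, b + 3)%N
  else if (a == 4)%N && (5 <= b <= 6)%N then (1%:Z, b + 4)%N
  else if (2 <= a <= 5)%N && (b == 11 - a)%N then (((-1) ^+ a)%R, 11%N)
  else (0%:Z, 0%N).

(* Solvable extension R(g,1) of an m-dimensional nilpotent g: basis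
   e_1..e_m, x = e_(m+1); [e_a, x] = w a * e_a. *)
Definition ext (m : nat) (g : nat -> nat -> int * nat) (w : nat -> int)
  (a b : nat) : int * nat :=
  if (b == m.+1)%N then (w a, a) else g a b.

Definition w3n1 (n a : nat) : int :=
  if (a == 1)%N then 1 else if (a == n)%N then 2 else (a.+1)%:Z.
Definition widx (a : nat) : int := a%:Z.

Definition C : fieldType := (Rdefinitions.R)[i].

Definition R3n1 (n : nat) : 'I_n.+1 -> 'I_n.+1 -> 'rV[C]_n.+1 := @table C n.+1 (ext n (g3n1 n) (w3n1 n)).
Definition R17 := @table C 8 (ext 7 g17 widx).
Definition R29 := @table C 10 (ext 9 g29 widx).
Definition R311 := @table C 12 (ext 11 g311 widx).
Arguments R3n1 n : clear implicits.

(* Main.v *)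
From HB Require Import structures.
Require Import Defs.
From mathcomp Require Import all_boot all_order all_algebra.
From mathcomp Require Import Rstruct complex.
From mathcomp Require Import ring zify.
Set Implicit Arguments. Unset Strict Implicit. Unset Printing Implicit Defensive.
Import Order.TTheory GRing.Theory Num.Theory.
Local Open Scope ring_scope.

(** In each of these algebras [ad x] is diagonal and its eigenvalues are, up to
    sign, [0, 1, ..., m], each once: the basis is relabelled by weight, [x] having
    weight [0], and the bracket of the vectors of weights [a] and [b] is a multiple
    [l a b] of the vector of weight [a + b].  Since [ad x] acts trivially on
    cohomology, every 2-cocycle is cohomologous to one of weight zero,
    i.e. to a family [c a b] of scalars, and those modulo the coboundaries
    [l a b * (p a + p b - p (a + b))] form a small linear problem.  A suitable
    choice of [p] makes [c] vanish on a set [gauge] of pairs; the cocycle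
    identities then express all of [c] through one value [c a0 b0].  There [l]
    vanishes, so that [c a0 b0] is not changed by coboundaries, and an explicit
    cocycle with [c a0 b0 <> 0] shows that the dimension is exactly one.  For
    [g3n1] this pair of weights is [(1, 2)]; for the three others it is [(1, m - 1)]. *)

(** * Linear structure of the cochain complex *)

Section Linearity.
Variables (F : fieldType) (N : nat) (bt : 'I_N -> 'I_N -> 'rV[F]_N).

Lemma lbr_ebas (i : 'I_N) (v : 'rV_N) : lbr bt (ebas F i) v = \sum_j v 0 j *: bt i j.
Proof.
rewrite /lbr (bigD1 i) //= [X in _ + X]big1 ?addr0 => [|k /negPf ki].
  by apply: eq_bigr => j _; rewrite mxE !eqxx mul1r.
by rewrite big1 // => j _; rewrite mxE ki andbF mul0r scale0r.
Qed.

Lemma ev2_ebas (phi : C2 F N) (v : 'rV_N) (k : 'I_N) :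
  ev2 phi v (ebas F k) = \sum_i v 0 i *: phi (i, k).
Proof.
apply: eq_bigr => i _; rewrite (bigD1 k) //= [X in _ + X]big1 ?addr0 => [|j /negPf jk].
  by rewrite mxE !eqxx mulr1.
by rewrite mxE jk andbF mulr0 scale0r.
Qed.

Lemma lbr_is_linear (x : 'rV_N) : linear (lbr bt x).
Proof.
move=> a u v; rewrite scaler_sumr -big_split; apply: eq_bigr => i _ /=.
rewrite scaler_sumr -big_split; apply: eq_bigr => j _ /=.
by rewrite !mxE mulrDr scalerDl scalerA mulrCA.
Qed.
HB.instance Definition _ (x : 'rV_N) :=
  GRing.isLinear.Build F 'rV_N 'rV_N _ (lbr bt x) (lbr_is_linear x).

Lemma ev1P (a : F) (psi psi' : C1 F N) (x : 'rV_N) :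
  ev1 (a *: psi + psi') x = a *: ev1 psi x + ev1 psi' x.
Proof.
rewrite scaler_sumr -big_split; apply: eq_bigr => i _ /=.
by rewrite !ffunE scalerDr !scalerA mulrC.
Qed.

Lemma ev2P (a : F) (phi phi' : C2 F N) (x y : 'rV_N) :
  ev2 (a *: phi + phi') x y = a *: ev2 phi x y + ev2 phi' x y.
Proof.
rewrite scaler_sumr -big_split; apply: eq_bigr => i _ /=.
rewrite scaler_sumr -big_split; apply: eq_bigr => j _ /=.
by rewrite !ffunE scalerDr !scalerA [X in X *: _]mulrC.
Qed.

Lemma altdefect_is_linear : linear (@altdefect F N).
Proof.
move=> a phi phi'; apply/ffunP => p; rewrite !ffunE.
by case: eqP => // _; rewrite scalerDr addrACA.
Qed.
HB.instance Definition _ :=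
  GRing.isLinear.Build F (C2 F N) (C2 F N) _ (@altdefect F N) altdefect_is_linear.

Lemma d1_is_linear : linear (d1 bt).
Proof.
move=> a psi psi'; apply/ffunP => p; rewrite !ffunE ev1P !linearP.
by apply/rowP => k; rewrite !mxE; ring.
Qed.
HB.instance Definition _ :=
  GRing.isLinear.Build F (C1 F N) (C2 F N) _ (d1 bt) d1_is_linear.

Lemma d2_is_linear : linear (d2 bt).
Proof.
move=> a phi phi'; apply/ffunP => -[[i j] k]; rewrite !ffunE !ev2P !linearP.
by apply/rowP => l; rewrite !mxE; ring.
Qed.
HB.instance Definition _ :=
  GRing.isLinear.Build F (C2 F N) (C3 F N) _ (d2 bt) d2_is_linear.

Lemma mem_Z2 (phi : C2 F N) :
  (phi \in Z2 bt) = (altdefect phi == 0) && (d2 bt phi == 0).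
Proof. by rewrite memv_cap !memv_ker !lfunE. Qed.

Lemma mem_B2 (phi : C2 F N) : reflect (exists psi, phi = d1 bt psi) (phi \in B2 bt).
Proof.
apply: (iffP memv_imgP) => [[psi _ ->]|[psi ->]]; exists psi; rewrite ?memvf ?lfunE //.
Qed.

(** The hypotheses amount to a direct sum decomposition of [Z2] into [B2] and the line spanned by
    [phi]; the inclusion of [B2] in [Z2] keeps the truncated difference of dimensions meaningful. *)
Lemma dimH2_eq1 (phi : C2 F N) :
  phi \in Z2 bt -> phi \notin B2 bt -> (forall psi, d1 bt psi \in Z2 bt) ->
  (forall phi', phi' \in Z2 bt -> exists psi t, phi' = d1 bt psi + t *: phi) ->
  dimH2 bt = 1%N.
Proof.
move=> Zphi nBphi BZ ZB; rewrite /dimH2.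
have -> : Z2 bt = (B2 bt + <[phi]>)%VS.
  apply/eqP; rewrite eqEsubv subv_add -memvE Zphi andbT; apply/andP; split.
    apply/subvP => phi' /ZB[psi [t ->]]; rewrite memv_add ?memvZ ?memv_line //.
    by apply/mem_B2; exists psi.
  by apply/subvP => phi' /mem_B2[psi ->].
rewrite dimv_disjoint_sum ?dim_vline; last first.
  apply/eqP; rewrite -subv0; apply/subvP => v; rewrite memv_cap => /andP[Bv /vlineP[k vE]].
  have [k0|k0] := eqVneq k 0; first by rewrite vE k0 scale0r mem0v.
  by case/negP: nBphi; rewrite -[phi](scalerK k0) -vE memvZ.
have -> : phi != 0 by apply: contraNneq nBphi => ->; rewrite mem0v.
by rewrite addKn.
Qed.
End Linearity.

(** * Algebras graded by the weights of [x] *)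

(* The coefficient of the coboundary of a weight-zero cochain [c] on weights [a], [b],
   [d].  The Jacobi identity for [l] is half of [jac l l = 0]. *)
Definition jac (R : pzRingType) (l c : nat -> nat -> R) (a b d : nat) : R :=
  l a (b + d)%N * c b d - l b (a + d)%N * c a d + l d (a + b)%N * c a b
  - l a b * c (a + b)%N d + l a d * c (a + d)%N b - l b d * c (b + d)%N a.

Section Graded.
Variables (F : numFieldType) (n : nat) (l : nat -> nat -> F).
Hypothesis l_anti : forall a b, l b a = - l a b.
Hypothesis l_big : forall a b, (n < a + b)%N -> l a b = 0.
Hypothesis l_x : forall a, (a <= n)%N -> l a 0 = a%:R.
Hypothesis l_jac : forall a b d, (a + b + d <= n)%N -> jac l l a b d = 0.

(* [adg a v] are the coordinates of the bracket of the basis vector of weight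
   [a] with the vector whose coordinate of weight [s] is [v s]. *)
Definition adg (a : nat) (v : nat -> F) (d : nat) : F :=
  if (a <= d)%N then l a (d - a)%N * v (d - a)%N else 0.

(** [cd1] and [cd2] are [d1] and [d2] in weight coordinates: [q a d] and [p a b d] stand for the
    coordinate of weight [d] of the value on basis vectors of weights [a], resp. [a] and [b]. *)
Definition cd1 (q : nat -> nat -> F) (a b d : nat) : F :=
  adg a (q b) d - adg b (q a) d - l a b * q (a + b)%N d.

Definition cd2 (p : nat -> nat -> nat -> F) (a b c d : nat) : F :=
  adg a (p b c) d - adg b (p a c) d + adg c (p a b) d
  - l a b * p (a + b)%N c d + l a c * p (a + c)%N b d - l b c * p (b + c)%N a d.

Lemma jacobi_identity a b s : (a + b + s <= n)%N ->
  l a (b + s)%N * l b s - l b (a + s)%N * l a s = l a b * l (a + b)%N s.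
Proof.
move=> /l_jac; rewrite /jac (l_anti (a + b) s) (l_anti (a + s) b) (l_anti (b + s) a).
move=> E; apply/eqP; rewrite -subr_eq0; apply/eqP.
have /mulfI: 2%:R != 0 :> F by rewrite pnatr_eq0.
by apply; rewrite mulr0 -[RHS]E; ring.
Qed.

(** The adjoint action is a representation: this is the Jacobi identity for [a], [b] and the third
    weight [d - (a + b)]. For [d < a + b] both sides vanish. *)
Lemma adg_comm a b v d : (d <= n)%N ->
  adg a (adg b v) d - adg b (adg a v) d = l a b * adg (a + b) v d.
Proof.
move=> dn; have [abd|abd] := leqP (a + b) d; last first.
  have adg2_0 x y : (d < x + y)%N -> adg x (adg y v) d = 0.
    by rewrite /adg => xyd; case: ifP => // xd; rewrite ifF ?mulr0 //; lia.
  by rewrite !adg2_0 ?subrr ?(addnC b) // /adg ifF ?mulr0 //; lia.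
rewrite /adg abd.
have [-> ->] : (a <= d)%N /\ (b <= d)%N by lia.
have [-> ->] : (b <= d - a)%N /\ (a <= d - b)%N by lia.
have -> : (d - b - a = d - (a + b))%N by lia.
have -> : (d - a - b = d - (a + b))%N by lia.
have -> : (d - a = b + (d - (a + b)))%N by lia.
have -> : (d - b = a + (d - (a + b)))%N by lia.
rewrite 2!mulrA -mulrBl jacobi_identity ?mulrA //; lia.
Qed.

Lemma adgB a u v w (x : F) d :
  adg a (fun s => u s - v s - x * w s) d = adg a u d - adg a v d - x * adg a w d.
Proof. by rewrite /adg; case: ifP => _; ring. Qed.

(** The terms group into three commutators, each replaced by means of [adg_comm], and a Jacobi sum
    that multiplies [q (a + b + c)]. *)
Lemma cd2_cd1 q a b c d :
  (a <= n)%N -> (b <= n)%N -> (c <= n)%N -> (d <= n)%N -> cd2 (cd1 q) a b c d = 0.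
Proof.
move=> an bn cn dn; rewrite /cd2 /cd1 !adgB.
have Eab := adg_comm a b (q c) dn; have Eac := adg_comm a c (q b) dn.
have Ebc := adg_comm b c (q a) dn.
have J : (l a b * l (a + b)%N c - l a c * l (a + c)%N b + l b c * l (b + c)%N a)
  * q (a + b + c)%N d = 0.
  have [abcn|abcn] := leqP (a + b + c) n; last first.
    by rewrite (@l_big (a + b)) ?(@l_big (a + c)) ?(@l_big (b + c)); first ring; lia.
  rewrite -jacobi_identity // (l_anti b (a + c)) (l_anti a (b + c)).
  by ring.
have -> : (a + c + b = a + b + c)%N by lia.
have -> : (b + c + a = a + b + c)%N by lia.
rewrite -[RHS](subrr 0) -{1}J.
transitivity ((adg a (adg b (q c)) d - adg b (adg a (q c)) d)
  - (adg a (adg c (q b)) d - adg c (adg a (q b)) d)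
  + (adg b (adg c (q a)) d - adg c (adg b (q a)) d)
  - l a b * adg (a + b)%N (q c) d + l a c * adg (a + c)%N (q b) d
  - l b c * adg (b + c)%N (q a) d
  + (l a b * l (a + b)%N c - l a c * l (a + c)%N b + l b c * l (b + c)%N a)
    * q (a + b + c)%N d); first ring.
by rewrite Eab Eac Ebc J; ring.
Qed.

(** The values of [p] at sums of two weights cancel, and what remains is the Jacobi sum times the
    symmetric factor [p a + p b + p d - p (a + b + d)]. *)
Lemma jac_coboundary p a b d : (a + b + d <= n)%N ->
  jac l (fun a b => l a b * (p a + p b - p (a + b)%N)) a b d = 0.
Proof.
move=> abd; have := jacobi_identity abd; rewrite /jac /=.
have -> : (a + d + b = a + b + d)%N by lia.
have -> : (b + d + a = a + b + d)%N by lia.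
rewrite (l_anti d (a + b)) (l_anti a (b + d)) (l_anti b (a + d)) => J.
transitivity ((p a + p b + p d - p (a + b + d)%N)
  * (l a (b + d)%N * l b d - l b (a + d)%N * l a d + l d (a + b)%N * l a b)); first ring.
by rewrite J; ring.
Qed.

(** * Weight-zero cocycles modulo coboundaries *)

Definition cocycle0 (c : nat -> nat -> F) : Prop :=
  (forall a b, c b a = - c a b) /\
  (forall a b d, (a + b + d <= n)%N -> jac l c a b d = 0).

Variables (c0 : nat -> nat -> F) (gauge : nat -> nat -> Prop) (a0 b0 : nat).
Hypothesis c0_cocycle : cocycle0 c0.
Hypothesis c0_x : forall b, c0 0 b = 0.
Hypothesis ab0 : [/\ (0 < a0)%N, (0 < b0)%N & (a0 + b0 <= n)%N].
Hypothesis l_ab0 : l a0 b0 = 0.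
Hypothesis c0_ab0 : c0 a0 b0 != 0.
Hypothesis gauge_dom : forall a b, gauge a b -> [/\ (0 < a)%N, (0 < b)%N & (a + b <= n)%N].
Hypothesis c0_gauge : forall a b, gauge a b -> c0 a b = 0.
Hypothesis gauge_norm : forall c : nat -> nat -> F, exists p : nat -> F,
  forall a b, gauge a b -> c a b = l a b * (p a + p b - p (a + b)%N).
Hypothesis gauge_uniq : forall c, cocycle0 c -> (forall a b, gauge a b -> c a b = 0) ->
  c a0 b0 = 0 -> forall a b, (0 < a)%N -> (a < b)%N -> (a + b <= n)%N -> c a b = 0.
Hypothesis diag_der : forall q : nat -> F,
  (forall a b, (0 < a)%N -> (a < b)%N -> (a + b <= n)%N ->
     l a b * (q a + q b - q (a + b)%N) = 0) ->
  forall a, (0 < a <= n)%N -> q a = a%:R * q 1%N.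

Lemma anti_diag (c : nat -> nat -> F) a : (forall a b, c b a = - c a b) -> c a a = 0.
Proof. by move/(_ a a)/eqP; rewrite -addr_eq0 -mulr2n mulrn_eq0 => /eqP. Qed.

(** The identity for [x] and two other weights says that [c 0] is a diagonal derivation of the part
    of positive weight, and [diag_der] leaves only the multiples of the grading. *)
Lemma cocycle0_x c : cocycle0 c -> exists s, forall a, (a <= n)%N -> c 0%N a = a%:R * s.
Proof.
move=> [c_anti cJ]; exists (c 0%N 1%N) => -[|a] an.
  by rewrite mul0r anti_diag.
apply: (diag_der (q := c 0%N)); last exact: an.
move=> {an}a b a_gt0 ab abn.
apply: oppr_inj; rewrite oppr0 -[RHS](cJ 0%N a b) // /jac !add0n.
rewrite (l_anti a 0) (l_anti b 0) (l_anti (a + b) 0).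
rewrite (c_anti 0%N (a + b)%N) (c_anti a b) (l_anti a b) !l_x ?natrD; try lia.
by ring.
Qed.

(** After subtraction of a coboundary and of a multiple of [c0], the difference [e] vanishes against
    [x], on the gauge and at the pair [a0], [b0], so that [gauge_uniq] applies. *)
Lemma cocycle0_class c : cocycle0 c -> exists p t, forall a b, (a + b <= n)%N ->
  c a b = l a b * (p a + p b - p (a + b)%N) + t * c0 a b.
Proof.
move=> cC; have [s cx] := cocycle0_x cC; have [c_anti cJ] := cC.
have [p' Sp'] := gauge_norm c; have [c0_anti c0J] := c0_cocycle.
(* The gauge involves positive weights only, so [p 0] is free: as [l 0 y = - y], the value [- s]
   makes the coboundary equal to [c] on the pairs with [x]. Since [l a0 b0 = 0], [t] is forced by
   the value at [a0], [b0]. *)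
pose p a := if a == 0%N then - s else p' a; pose t := c a0 b0 / c0 a0 b0.
exists p, t; pose e a b := c a b - l a b * (p a + p b - p (a + b)%N) - t * c0 a b.
suff e0 a b : (a + b <= n)%N -> e a b = 0.
  by move=> a b /e0/eqP; rewrite /e -addrA -opprD subr_eq0 => /eqP.
have e_anti x y : e y x = - e x y.
  by rewrite /e (c_anti x) (c0_anti x) (l_anti x) (addnC x); ring.
have eC : cocycle0 e.
  split=> // x y z xyz.
  rewrite -[RHS](subrr 0) -{1}(cJ x y z xyz) -(jac_coboundary p xyz).
  transitivity (jac l c x y z - jac l (fun a b => l a b * (p a + p b - p (a + b)%N)) x y z
     - t * jac l c0 x y z); first by rewrite /jac /e; ring.
  by rewrite c0J // mulr0 subr0.
have ex y : (y <= n)%N -> e 0%N y = 0.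
  by move=> yn; rewrite /e c0_x cx // (l_anti y 0) l_x // add0n /p eqxx; ring.
have eS x y : gauge x y -> e x y = 0.
  move=> Sxy; rewrite /e c0_gauge // Sp' // /p.
  by case: (gauge_dom Sxy) => ? ? _; rewrite !ifF; first ring; lia.
have eab0 : e a0 b0 = 0 by rewrite /e l_ab0 /t divfK // mul0r subr0 subrr.
have e_pos := gauge_uniq eC eS eab0.
move=> abn; have [a_eq0|a_gt0] := posnP a; first by rewrite a_eq0 ex //; lia.
have [b_eq0|b_gt0] := posnP b; first by rewrite e_anti b_eq0 ex ?oppr0 //; lia.
have [ab|ba|->] := ltngtP a b; [|rewrite e_anti|exact: anti_diag].
  exact: e_pos.
by rewrite e_pos ?oppr0 // addnC.
Qed.

(* Pairing a cocycle with [x] gives a cochain [chi] whose coboundary is the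
   weight operator applied to the cocycle, so that all components of nonzero weight are exact. *)
Lemma cd2_x p a b d : (forall a b d, p b a d = - p a b d) ->
  (a <= n)%N -> (b <= n)%N -> (d <= n)%N ->
  cd2 p 0 a b d = (a%:R + b%:R - d%:R) * p a b d - cd1 (p 0%N) a b d.
Proof.
move=> p_anti an bn dn; rewrite /cd2 /cd1 {1}/adg !add0n /= subn0.
rewrite (l_anti d 0) (l_anti a 0) (l_anti b 0) !l_x // (p_anti 0%N (a + b)%N).
by rewrite (p_anti a b); ring.
Qed.

(** Only the coordinate of weight [s = d - a] enters, and there [b - s = a + b - d]. Hence the three
    terms of [cd1] acquire the same divisor. *)
Lemma adg_scale (q q' : nat -> F) a b d :
  (forall s, (s <= n)%N -> s != b -> q' s = q s / (b%:R - s%:R)) ->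
  (d <= n)%N -> d != (a + b)%N ->
  adg a q' d = adg a q d / (a%:R + b%:R - d%:R).
Proof.
move=> q'E dn dab; rewrite /adg; case: ifP => ad; last by rewrite mul0r.
rewrite q'E; try lia; rewrite natrB // mulrA; congr (_ / _); ring.
Qed.

Lemma cocycle_class p : (forall a b d, p b a d = - p a b d) ->
  (forall a b c d, (a <= n)%N -> (b <= n)%N -> (c <= n)%N -> (d <= n)%N -> cd2 p a b c d = 0) ->
  exists q t, forall a b d, (a <= n)%N -> (b <= n)%N -> (d <= n)%N ->
    p a b d = cd1 q a b d + t * (if d == (a + b)%N then c0 a b else 0).
Proof.
move=> p_anti pZ.
have chiE a b d : (a <= n)%N -> (b <= n)%N -> (d <= n)%N ->
    cd1 (p 0%N) a b d = (a%:R + b%:R - d%:R) * p a b d.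
  move=> an bn dn; apply/esym/eqP; rewrite -subr_eq0 -cd2_x //.
  by rewrite pZ.
have [|r [t rE]] := @cocycle0_class (fun a b => p a b (a + b)%N).
  split=> [a b|a b d abd]; first by rewrite p_anti addnC.
  rewrite -[RHS](pZ a b d (a + b + d)%N) //; try lia.
  rewrite /cd2 /jac /adg !ifT; try lia.
  have -> : (a + d + b = a + b + d)%N by lia.
  have -> : (b + d + a = a + b + d)%N by lia.
  have -> : (a + b + d - a = b + d)%N by lia.
  have -> : (a + b + d - b = a + d)%N by lia.
  by have -> : (a + b + d - d = a + b)%N by lia.
(* The diagonal is the weight-zero part, given by [cocycle0_class]; off the diagonal the cochain
   [p 0] is divided by its nonzero weight [a - d], which inverts the factor in [chiE]. *)
exists (fun a d => if a == d then r a else p 0%N a d / (a%:R - d%:R)), t.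
move=> a b d an bn dn; case: eqVneq => [d_ab|dab].
  rewrite d_ab rE -?d_ab // /cd1 /adg d_ab leq_addr leq_addl addKn addnK !eqxx.
  by rewrite (l_anti a b); ring.
have w0 : a%:R + b%:R - d%:R != 0 :> F by rewrite subr_eq0 -natrD eqr_nat eq_sym.
rewrite mulr0 addr0 /cd1 (@adg_scale (p 0%N b) _ a b) //; last first.
  by move=> s _ /negPf; rewrite eq_sym => ->.
rewrite (@adg_scale (p 0%N a) _ b a) //; last 2 first.
- by move=> s _ /negPf; rewrite eq_sym => ->.
- by rewrite addnC.
rewrite [(a + b)%N == d]eq_sym (negPf dab) natrD (addrC b%:R) mulrA -!mulrBl.
by rewrite -[X in X / _]/(cd1 _ a b d) chiE // mulrC mulKf.
Qed.

(** * From weight coordinates back to a bracket table *)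

Variables (bt : 'I_n.+1 -> 'I_n.+1 -> 'rV[F]_n.+1) (wt u : nat -> nat).
Hypothesis wt_le : forall i, (i <= n)%N -> (wt i <= n)%N.
Hypothesis u_le : forall a, (a <= n)%N -> (u a <= n)%N.
Hypothesis uK : forall a, (a <= n)%N -> wt (u a) = a.
Hypothesis wtK : forall i, (i <= n)%N -> u (wt i) = i.
Hypothesis btE : forall i j k : 'I_n.+1,
  bt i j 0 k = if wt k == (wt i + wt j)%N then l (wt i) (wt j) else 0.

Definition vecw (a : nat) : 'I_n.+1 := inord (u a).
Local Notation e := vecw.

Lemma wt_vecw a : (a <= n)%N -> wt (e a) = a.
Proof. by move=> an; rewrite /e inordK ?uK // ltnS u_le. Qed.

Lemma vecw_wt (i : 'I_n.+1) : e (wt i) = i.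
Proof. by rewrite /e wtK ?inord_val // -ltnS. Qed.

Lemma wt_ord_le (i : 'I_n.+1) : (wt i <= n)%N.
Proof. by rewrite wt_le // -ltnS. Qed.

Lemma lbr_vecw a (v : 'rV_n.+1) d : (a <= n)%N -> (d <= n)%N ->
  lbr bt (ebas F (e a)) v 0 (e d) = adg a (fun s => v 0 (e s)) d.
Proof.
move=> an dn; rewrite lbr_ebas summxE /adg; case: leqP => ad; last first.
  by apply: big1 => j _; rewrite mxE btE !wt_vecw // ifF ?mulr0 //; lia.
rewrite (bigD1 (e (d - a))) //= big1 ?addr0 => [|j /eqP jE].
  by rewrite mxE btE !wt_vecw ?subnKC ?eqxx //; [rewrite mulrC | lia].
rewrite mxE btE !wt_vecw // ifF ?mulr0 //; apply/eqP => dE; apply: jE.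
by rewrite -(vecw_wt j) dE addKn.
Qed.

(** When [n < a + b] the index [e (a + b)] has no meaning, but its coefficient vanishes by
    [l_big]. *)
Lemma sum_bt_vecw (f : 'I_n.+1 -> 'rV[F]_n.+1) a b : (a <= n)%N -> (b <= n)%N ->
  \sum_i bt (e a) (e b) 0 i *: f i = l a b *: f (e (a + b)%N).
Proof.
move=> an bn; have [abn|abn] := leqP (a + b) n; last first.
  rewrite l_big // scale0r; apply: big1 => i _; rewrite btE !wt_vecw // ifF ?scale0r //.
  by have := wt_ord_le i; lia.
rewrite (bigD1 (e (a + b))) //= big1 ?addr0 => [|i /eqP iE].
  by rewrite btE !wt_vecw ?eqxx.
rewrite btE !wt_vecw // ifF ?scale0r //; apply/eqP => wi; apply: iE.
by rewrite -(vecw_wt i) wi.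
Qed.

Lemma d1_vecw (psi : C1 F n.+1) (q : nat -> nat -> F) a b d :
  (forall a d, (a <= n)%N -> (d <= n)%N -> psi (e a) 0 (e d) = q a d) ->
  (a <= n)%N -> (b <= n)%N -> (d <= n)%N ->
  d1 bt psi (e a, e b) 0 (e d) = cd1 q a b d.
Proof.
move=> psiE an bn dn; rewrite ffunE /ev1 /= sum_bt_vecw // !mxE !lbr_vecw // /cd1 /adg /=.
have -> : l a b * psi (e (a + b)%N) 0 (e d) = l a b * q (a + b)%N d.
  have [abn|abn] := leqP (a + b) n; first by rewrite psiE.
  by rewrite l_big // !mul0r.
by rewrite !psiE //; lia.
Qed.

Lemma d2_vecw (phi : C2 F n.+1) (p : nat -> nat -> nat -> F) a b c d :
  (forall a b d, (a <= n)%N -> (b <= n)%N -> (d <= n)%N ->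
     phi (e a, e b) 0 (e d) = p a b d) ->
  (a <= n)%N -> (b <= n)%N -> (c <= n)%N -> (d <= n)%N ->
  d2 bt phi (e a, e b, e c) 0 (e d) = cd2 p a b c d.
Proof.
move=> phiE an bn cn dn; rewrite ffunE !ev2_ebas !sum_bt_vecw // !mxE !lbr_vecw // /cd2 /adg /=.
have lE x y z : (x <= n)%N -> (y <= n)%N -> (z <= n)%N ->
    l x y * phi (e (x + y)%N, e z) 0 (e d) = l x y * p (x + y)%N z d.
  move=> xn yn zn; have [xyn|xyn] := leqP (x + y) n; first by rewrite phiE.
  by rewrite l_big // !mul0r.
by rewrite !lE // !phiE //; lia.
Qed.

Lemma C2_eqP (phi phi' : C2 F n.+1) :
  (forall a b d, (a <= n)%N -> (b <= n)%N -> (d <= n)%N ->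
     phi (e a, e b) 0 (e d) = phi' (e a, e b) 0 (e d)) -> phi = phi'.
Proof.
move=> E; apply/ffunP => -[i j]; apply/rowP => k.
by rewrite -(vecw_wt i) -(vecw_wt j) -(vecw_wt k) E ?wt_ord_le.
Qed.

Lemma mem_Z2_vecw (phi : C2 F n.+1) (p : nat -> nat -> nat -> F) :
  (forall a b d, (a <= n)%N -> (b <= n)%N -> (d <= n)%N ->
     phi (e a, e b) 0 (e d) = p a b d) ->
  (forall a b d, p b a d = - p a b d) ->
  (forall a b c d, (a <= n)%N -> (b <= n)%N -> (c <= n)%N -> (d <= n)%N ->
     cd2 p a b c d = 0) ->
  phi \in Z2 bt.
Proof.
move=> phiE p_anti pZ; rewrite mem_Z2; apply/andP; split; apply/eqP.
  apply: C2_eqP => a b d an bn dn.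
  rewrite /altdefect ffunE.
  rewrite [in RHS]ffunE.
  rewrite mxE /=.
  case: eqP => [<-|_].
    rewrite phiE //.
    by apply: (anti_diag (c := fun a b => p a b d)).
  rewrite mxE.
  by rewrite !phiE // p_anti addrC addrN.
apply/ffunP => -[[i j] k]; apply/rowP => m.
rewrite -(vecw_wt i) -(vecw_wt j) -(vecw_wt k) -(vecw_wt m) (d2_vecw phiE) ?wt_ord_le //.
by rewrite pZ ?wt_ord_le // !ffunE mxE.
Qed.

Definition weight0_cochain : C2 F n.+1 :=
  [ffun ij : 'I_n.+1 * 'I_n.+1 =>
     \row_k if wt k == (wt ij.1 + wt ij.2)%N then c0 (wt ij.1) (wt ij.2) else 0].

Lemma weight0_cochainE a b d : (a <= n)%N -> (b <= n)%N -> (d <= n)%N ->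
  weight0_cochain (e a, e b) 0 (e d) = if d == (a + b)%N then c0 a b else 0.
Proof. by move=> an bn dn; rewrite ffunE mxE !wt_vecw. Qed.

(** The coboundary again has weight zero: only the coordinate [d = a + b + c] can survive, and there
    [cd2] is [jac]. *)
Lemma weight0_cochain_Z2 : weight0_cochain \in Z2 bt.
Proof.
have [c0_anti c0J] := c0_cocycle.
apply: mem_Z2_vecw weight0_cochainE _ _ => [a b d|a b c d an bn cn dn].
  by rewrite addnC c0_anti; case: ifP => _; rewrite ?oppr0.
have [dE|dE] := eqVneq d (a + b + c)%N.
  rewrite -[RHS](c0J a b c) -?dE // /cd2 /jac /adg dE !ifT; try lia.
  have -> : (a + b + c - a = b + c)%N by lia.
  have -> : (a + b + c - b = a + c)%N by lia.
  by have -> : (a + b + c - c = a + b)%N by lia.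
have adg0 x y z : (x + y + z != d)%N ->
    adg x (fun s => if s == (y + z)%N then c0 y z else 0) d = 0.
  by move=> xyz; rewrite /adg; case: leqP => // xd; rewrite ifF ?mulr0 //; lia.
rewrite /cd2 !adg0 ?ifF; try lia.
by rewrite !mulr0 !subr0 !addr0.
Qed.

(** At the pair [a0], [b0] and weight [a0 + b0], every term of a coboundary carries the factor
    [l a0 b0] up to sign, which is zero, whereas [c0 a0 b0] is not. *)
Lemma weight0_cochain_notB2 : weight0_cochain \notin B2 bt.
Proof.
have [a0_gt0 b0_gt0 abn] := ab0; have [a0n b0n] : (a0 <= n)%N /\ (b0 <= n)%N by lia.
apply/mem_B2 => -[psi phiE]; case/eqP: c0_ab0.
have := @d1_vecw psi (fun a d => psi (e a) 0 (e d)) a0 b0 (a0 + b0)%N.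
rewrite -phiE weight0_cochainE // eqxx => -> //.
by rewrite /cd1 /adg leq_addr leq_addl addKn addnK (l_anti a0) l_ab0 oppr0 !mul0r !subr0.
Qed.

Theorem dimH2_graded : dimH2 bt = 1%N.
Proof.
apply: dimH2_eq1 weight0_cochain_Z2 weight0_cochain_notB2 _ _ => [psi|phi].
  pose q a d := psi (e a) 0 (e d).
  apply: (@mem_Z2_vecw _ (cd1 q)) => [a b d an bn dn|a b d|a b c d]; last exact: cd2_cd1.
    exact: d1_vecw.
  by rewrite /cd1 (l_anti a b) addnC; ring.
rewrite mem_Z2 => /andP[/eqP alt_phi /eqP d2_phi].
pose p a b d := phi (e a, e b) 0 (e d).
have p_anti a b d : p b a d = - p a b d.
  have /ffunP/(_ (e a, e b)) := alt_phi; rewrite !ffunE /= /p.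
  case: eqP => [<-|_] /rowP/(_ (e d)); rewrite !mxE => E; first by rewrite E oppr0.
  by apply/eqP; rewrite -addr_eq0 addrC E.
have [|q [t pE]] := @cocycle_class p p_anti.
  by move=> a b c d an bn cn dn; rewrite -(@d2_vecw phi) // d2_phi !ffunE mxE.
exists [ffun i : 'I_n.+1 => \row_k q (wt i) (wt k)], t.
apply: C2_eqP => a b d an bn dn.
have coordE (x y : C2 F n.+1) ij k : (x + t *: y) ij 0 k = x ij 0 k + t * y ij 0 k.
  by rewrite !ffunE !mxE.
rewrite -/(p a b d) pE // coordE weight0_cochainE // (@d1_vecw _ q) //.
by move=> x y xn yn; rewrite ffunE mxE !wt_vecw.
Qed.

End Graded.

(** * Graded algebras given by integer tables *)

Definition asym (t : nat -> nat -> int) (a b : nat) : int :=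
  if (a < b)%N then t a b else if (b < a)%N then - t b a else 0.

Lemma asym_anti t a b : asym t b a = - asym t a b.
Proof. by rewrite /asym; case: ltngtP; rewrite ?opprK ?oppr0. Qed.

(* Structure constants in the weight basis, with [x] of weight [0]; [g] gives
   those of the nilpotent part for weights [0 < a < b]. *)
Definition sconst (n : nat) (g : nat -> nat -> int) (a b : nat) : int :=
  if (n < a + b)%N then 0
  else asym (fun a b => if a == 0%N then - b%:Z else g a b) a b.

Definition cconst (h : nat -> nat -> int) : nat -> nat -> int :=
  asym (fun a b => if a == 0%N then 0 else h a b).

Lemma sconst_anti n g a b : sconst n g b a = - sconst n g a b.
Proof. by rewrite /sconst addnC; case: ifP; rewrite ?oppr0 // asym_anti. Qed.

Lemma sconst_x n g a : (a <= n)%N -> sconst n g a 0 = a%:Z.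
Proof.
by case: a => [|a] an //; rewrite sconst_anti /sconst /asym ltnNge an //= opprK.
Qed.

Lemma sconstE n g a b : (0 < a)%N -> (a < b)%N -> (a + b <= n)%N -> sconst n g a b = g a b.
Proof. by move=> a0 ab abn; rewrite /sconst ltnNge abn /asym ab gtn_eqF. Qed.

Lemma cconst_anti h a b : cconst h b a = - cconst h a b.
Proof. exact: asym_anti. Qed.

Lemma cconst_x h b : cconst h 0 b = 0.
Proof. by case: b. Qed.

Lemma cconstE h a b : (0 < a)%N -> (a < b)%N -> cconst h a b = h a b.
Proof. by move=> a0 ab; rewrite /cconst /asym ab gtn_eqF. Qed.

(** For antisymmetric [l] and [c] the expression [jac l c] is alternating in its three weights,
    which may therefore be sorted; a smallest weight [0] is the case of [x]. *)
Lemma jac_sorted (R : comPzRingType) (l c : nat -> nat -> R) n :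
  (forall a b, l b a = - l a b) -> (forall a, l a a = 0) ->
  (forall a b, c b a = - c a b) -> (forall a, c a a = 0) ->
  (forall b d, (b + d <= n)%N -> jac l c 0 b d = 0) ->
  (forall a b d, (0 < a)%N -> (a < b)%N -> (b < d)%N -> (a + b + d <= n)%N -> jac l c a b d = 0) ->
  forall a b d, (a + b + d <= n)%N -> jac l c a b d = 0.
Proof.
move=> l_anti l_diag c_anti c_diag J0 Jlt.
have swap12 a b d : jac l c b a d = - jac l c a b d.
  by rewrite /jac (l_anti a b) (addnC b a) (c_anti a b); ring.
have swap23 a b d : jac l c a d b = - jac l c a b d.
  by rewrite /jac (l_anti b d) (addnC d b) (c_anti b d); ring.
have diag12 a d : jac l c a a d = 0.
  by rewrite /jac l_diag c_diag; ring.
have diag23 a d : jac l c a d d = 0.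
  by rewrite /jac l_diag c_diag; ring.
have Jle a b d : (a < b)%N -> (b < d)%N -> (a + b + d <= n)%N -> jac l c a b d = 0.
  case: a => [|a] ab bd abd; first by rewrite J0 //; lia.
  exact: Jlt.
have J12 a b d : (a < b)%N -> (a + b + d <= n)%N -> jac l c a b d = 0.
  move=> ab abd; have [bd|db|<-] := ltngtP b d; first exact: Jle.
    rewrite -[RHS]oppr0 swap23; congr (- _).
    have [ad|da|<-] := ltngtP a d; first by rewrite Jle //; lia.
      by rewrite swap12 Jle ?oppr0 //; lia.
    by rewrite diag12.
  by rewrite diag23.
move=> a b d abd; have [ab|ba|<-] := ltngtP a b; first exact: J12.
  by rewrite swap12 J12 ?oppr0 //; lia.
by rewrite diag12.
Qed.

Section Tables.
Variables (F : numFieldType) (n : nat) (f : nat -> nat -> int * nat).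
Variables (g h : nat -> nat -> int) (wt u : nat -> nat).
Variables (gauge : nat -> nat -> Prop) (a0 b0 : nat).
Local Notation l := (sconst n g).
Local Notation lF := (fun a b => (l a b)%:~R : F).
Hypothesis wt_le : forall i, (i <= n)%N -> (wt i <= n)%N.
Hypothesis u_le : forall a, (a <= n)%N -> (u a <= n)%N.
Hypothesis uK : forall a, (a <= n)%N -> wt (u a) = a.
Hypothesis wtK : forall i, (i <= n)%N -> u (wt i) = i.
Hypothesis fE : forall i j k, (i < j)%N -> (j <= n)%N -> (k <= n)%N ->
  (if k.+1 == (f i.+1 j.+1).2 then (f i.+1 j.+1).1 else 0)
    = if wt k == (wt i + wt j)%N then l (wt i) (wt j) else 0.
Hypothesis gJ : forall a b d, (0 < a)%N -> (a < b)%N -> (b < d)%N -> (a + b + d <= n)%N ->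
  jac l l a b d = 0.
Hypothesis hJ : forall a b d, (0 < a)%N -> (a < b)%N -> (b < d)%N -> (a + b + d <= n)%N ->
  jac l (cconst h) a b d = 0.
Hypothesis ab0 : [/\ (0 < a0)%N, (a0 < b0)%N & (a0 + b0 <= n)%N].
Hypothesis g_ab0 : g a0 b0 = 0.
Hypothesis h_ab0 : h a0 b0 != 0.
Hypothesis gauge_dom : forall a b, gauge a b -> [/\ (0 < a)%N, (a < b)%N & (a + b <= n)%N].
Hypothesis h_gauge : forall a b, gauge a b -> h a b = 0.
Hypothesis gauge_norm : forall c : nat -> nat -> F, exists p : nat -> F,
  forall a b, gauge a b -> c a b = (g a b)%:~R * (p a + p b - p (a + b)%N).
Hypothesis gauge_uniq : forall c, cocycle0 n lF c -> (forall a b, gauge a b -> c a b = 0) ->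
  c a0 b0 = 0 -> forall a b, (0 < a)%N -> (a < b)%N -> (a + b <= n)%N -> c a b = 0.
Hypothesis diag_der : forall q : nat -> F,
  (forall a b, (0 < a)%N -> (a < b)%N -> (a + b <= n)%N ->
     (g a b)%:~R * (q a + q b - q (a + b)%N) = 0) ->
  forall a, (0 < a <= n)%N -> q a = a%:R * q 1%N.

Lemma jac_intr (l' c : nat -> nat -> int) a b d :
  jac (fun a b => (l' a b)%:~R : F) (fun a b => (c a b)%:~R) a b d = (jac l' c a b d)%:~R.
Proof. by rewrite /jac !(rmorphD, rmorphN, rmorphM) /=. Qed.

Lemma sconst_diag a : l a a = 0.
Proof. by rewrite /sconst /asym ltnn; case: ifP. Qed.

Lemma dimH2_table : dimH2 (@table F n.+1 f) = 1%N.
Proof.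
have jac_l a b d : (a + b + d <= n)%N -> jac l l a b d = 0.
  apply: jac_sorted => //; try exact: sconst_anti; try exact: sconst_diag.
  (* With [x] in the triple, every term is a multiple of [l b d], with coefficients that cancel
     because the weight of a bracket is the sum of the weights. *)
  move=> {}b {}d bdn; rewrite /jac !add0n (sconst_anti _ _ b 0) (sconst_anti _ _ d 0).
  rewrite (sconst_anti _ _ (b + d) 0) (sconst_anti _ _ b d) !sconst_x ?PoszD; lia.
have jac_c a b d : (a + b + d <= n)%N -> jac l (cconst h) a b d = 0.
  apply: jac_sorted => //; try exact: sconst_anti; try exact: sconst_diag; try exact: asym_anti.
    by move=> x; rewrite /cconst /asym ltnn.
  move=> {}b {}d bdn; rewrite /jac !add0n (sconst_anti _ _ b 0) (sconst_anti _ _ d 0)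
    (sconst_anti _ _ (b + d) 0).
  rewrite (cconst_anti _ b d) (cconst_anti _ 0 _) !cconst_x !sconst_x ?PoszD; lia.
have [a0_gt0 ab0_lt ab0n] := ab0.
apply: (@dimH2_graded F n lF _ _ _ _ (fun a b => (cconst h a b)%:~R) gauge a0 b0 _ _ _ _ _ _ _ _ _ _
  (@table F n.+1 f) wt u) => //=.
- by move=> a b; rewrite sconst_anti rmorphN.
- by move=> a b abn; rewrite /sconst abn.
- by move=> a an; rewrite sconst_x.
- by move=> a b d abd; rewrite jac_intr jac_l.
- split=> [a b|a b d abd]; first by rewrite cconst_anti rmorphN.
  by rewrite jac_intr jac_c.
- by move=> b; rewrite cconst_x.
- by split=> //; lia.
- by rewrite sconstE // g_ab0.
- by rewrite cconstE // intr_eq0.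
- by move=> a b /gauge_dom[? ? ?]; split => //; lia.
- by move=> a b Sab; have [? ? ?] := gauge_dom Sab; rewrite cconstE // h_gauge.
- move=> c; have [p Sp] := gauge_norm c; exists p => a b Sab.
  by have [? ? ?] := gauge_dom Sab; rewrite sconstE // Sp.
- move=> q qE; apply: diag_der => a b a_gt0 ab abn.
  by have := qE a b a_gt0 ab abn; rewrite sconstE.
have fE' (i j k : 'I_n.+1) : (i < j)%N ->
    (\row_k0 (if k0.+1 == (f i.+1 j.+1).2 then (f i.+1 j.+1).1%:~R else 0 : F)) 0 k
    = if wt k == (wt i + wt j)%N then (l (wt i) (wt j))%:~R else 0.
  move=> ij; have := @fE i j k ij; rewrite mxE -ltnS ltn_ord -ltnS ltn_ord => /(_ isT isT).
  by move/(congr1 (intr : int -> F)); do 2!case: ifP.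
move=> i j k; rewrite /table; case: ltngtP => [ij|ji|/val_inj ->]; first exact: fE'.
  by rewrite mxE fE' // addnC sconst_anti rmorphN; case: ifP; rewrite ?opprK ?oppr0.
by rewrite mxE sconst_diag if_same.
Qed.
End Tables.

(** * Algebras with a filiform nilradical *)

(** Makes a statement about all triples below a fixed bound provable by evaluating one boolean. *)
Lemma all_ltn3 N (P : nat -> nat -> nat -> bool) :
  all (fun i => all (fun j => all (P i j) (iota 0 N)) (iota 0 N)) (iota 0 N) ->
  forall i j k, (i < N)%N -> (j < N)%N -> (k < N)%N -> P i j k.
Proof.
move=> /allP all_P i j k iN jN kN.
have mem x : (x < N)%N -> x \in iota 0 N by rewrite mem_iota.
by have /allP/(_ _ (mem _ jN))/allP/(_ _ (mem _ kN)) := all_P _ (mem _ iN).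
Qed.

Section Filiform.
Variables (F : numFieldType) (m : nat) (f : nat -> nat -> int * nat) (h : nat -> nat -> int).
Let g a b := (f a b).1.
Let lF a b : F := (sconst m g a b)%:~R.
Hypothesis m_ge7 : (7 <= m)%N.

(** Indices start at [0]: index [i < m] is the basis vector [e_(i+1)], of weight [i + 1], and the
    last index [m] is [x]. *)
Definition wt_filiform (i : nat) : nat := (if i == m then 0 else i.+1)%N.
Definition label_filiform (a : nat) : nat := (if a == 0 then m else a.-1)%N.

Hypothesis g1 : forall i, (2 <= i <= m - 2)%N -> g 1 i = 1.
Hypothesis g1_last : g 1 m.-1 = 0.
Hypothesis g23 : g 2 3 = 1.
Hypothesis g2_last : g 2 (m - 2) = 1.
Hypothesis h1 : forall i, (2 <= i <= m - 2)%N -> h 1 i = 0.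
Hypothesis h1_last : h 1 m.-1 != 0.
Hypothesis h23 : h 2 3 = 0.
Hypothesis h2_last : h 2 (m - 2) = 0.
Hypothesis tableE : forall i j k, (i < m.+1)%N -> (j < m.+1)%N -> (k < m.+1)%N ->
  (i < j)%N ==>
  ((if k.+1 == (ext m f widx i.+1 j.+1).2 then (ext m f widx i.+1 j.+1).1 else 0)
   == if wt_filiform k == (wt_filiform i + wt_filiform j)%N
      then sconst m g (wt_filiform i) (wt_filiform j) else 0).
Hypothesis jacobi : forall a b d, (a < m.+1)%N -> (b < m.+1)%N -> (d < m.+1)%N ->
  [&& 0 < a, a < b, b < d & a + b + d <= m]%N ==>
  (jac (sconst m g) (sconst m g) a b d == 0) && (jac (sconst m g) (cconst h) a b d == 0).
Hypothesis uniq : forall c, cocycle0 m lF c ->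
  (forall i, (2 <= i <= m.-1)%N -> c 1%N i = 0) -> c 2%N 3%N = 0 -> c 2%N (m - 2)%N = 0 ->
  forall a b, (0 < a)%N -> (a < b)%N -> (a + b <= m)%N -> c a b = 0.

(** The pairs [(1, b)] with [b <= m - 2] prescribe the successive differences of [p], and [(2, 3)]
    its starting value. Since [g 1 m.-1 = 0], the value [p m] is reached through [(2, m - 2)]
    instead, and [(1, m - 1)] remains as the invariant pair. *)
Lemma dimH2_filiform : dimH2 (@table F m.+1 (ext m f widx)) = 1%N.
Proof.
pose gauge a b := (a = 1 /\ (2 <= b <= m - 2))%N \/ (a = 2 /\ (b = 3 \/ b = m - 2))%N.
apply: (@dimH2_table F m _ g h wt_filiform label_filiform gauge 1 m.-1) => //.
- by move=> i; rewrite /wt_filiform; case: eqP; lia.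
- by move=> a; rewrite /label_filiform; case: eqP; lia.
- by move=> a am; rewrite /wt_filiform /label_filiform; case: (a =P 0%N); case: eqP; lia.
- by move=> i im; rewrite /wt_filiform /label_filiform; case: (i =P m) => //; lia.
- move=> i j k ij jm km; have := @tableE i j k; rewrite ij /= => /(_ _ _ _)/eqP; apply; lia.
- move=> a b d a0 ab bd abd; have := @jacobi a b d; rewrite a0 ab bd abd /=.
  by case/(_ _ _ _)/andP; try lia; move/eqP.
- move=> a b d a0 ab bd abd; have := @jacobi a b d; rewrite a0 ab bd abd /=.
  by case/(_ _ _ _)/andP; try lia; move=> _ /eqP.
- by split=> //; lia.
- by move=> a b [[-> ?]|[-> [->|->]]]; split; lia.
- by move=> a b [[-> ?]|[-> [->|->]]] //; rewrite h1.
(* The constant in [r] solves [r 2 + r 3 - r 5 = c 2 3], and the value of [p] at [m] solves the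
   equation of the pair [(2, m - 2)]. *)
- move=> c; pose r k := c 2%N 3%N - c 1%N 3%N - c 1%N 4%N - \sum_(2 <= i < k) c 1%N i.
  pose p k := if k == 1%N then 0 else
    if k == m then r 2%N + r (m - 2)%N - c 2%N (m - 2)%N else r k.
  have rS k : (2 <= k)%N -> r k.+1 = r k - c 1%N k.
    by move=> k2; rewrite /r big_nat_recr //= opprD addrA.
  exists p => a b [[-> b2m]|[-> [->|->]]].
  - by rewrite g1 // /p eqxx !ifF ?add1n ?rS; try ring; lia.
  - have r2 : r 2%N = c 2%N 3%N - c 1%N 3%N - c 1%N 4%N by rewrite /r big_geq // subr0.
    rewrite g23 /p !ifF; try lia.
    rewrite (rS 4%N) // (rS 3%N) // (rS 2%N) // r2; ring.
  - rewrite g2_last /p (_ : (2 + (m - 2) = m)%N) ?eqxx; last lia.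
    by rewrite !ifF; try lia; ring.
- move=> c cC cS c_last; apply: uniq => //; try by apply: cS; right; auto.
  move=> i i2m; have [->|im] := eqVneq i m.-1; first by [].
  by apply: cS; left; split => //; lia.
- move=> q qE.
  have q1 i : (2 <= i <= m - 2)%N -> q i.+1 = q 1%N + q i.
    move=> i2; have := qE 1%N i; rewrite g1 // mul1r add1n.
    by move=> /(_ _ _ _)/eqP; rewrite subr_eq0 => E; apply/esym/eqP/E; lia.
  (* The bracket of weights 2 and 3 gives [q 5 = q 2 + q 3], while two steps by weight 1 give
     [q 5 = q 3 + 2 q 1]. *)
  have q2 : q 2%N = 2%:R * q 1%N.
    have := qE 2%N 3%N; rewrite g23 mul1r (q1 4%N) ?(q1 3%N) ?(q1 2%N); try lia.
    move=> /(_ isT isT _)/eqP; rewrite subr_eq0 => E.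
    have {}E := eqP (E _); apply: (addIr (q 1%N + q 2%N)); rewrite E; first ring; lia.
  have qlt a : (2 <= a < m)%N -> q a = a%:R * q 1%N.
    elim: a => // a IH am; have [->|a2] := eqVneq a 1%N; first by rewrite q2.
    by rewrite q1 ?IH -?[a.+1]addn1 ?natrD; try lia; ring.
  move=> a am; have [->|a1] := eqVneq a 1%N; first by rewrite mul1r.
  have [->|a_m] := eqVneq a m; last by apply: qlt; lia.
  have := qE 2%N (m - 2)%N; rewrite g2_last mul1r (_ : (2 + (m - 2) = m)%N); last lia.
  move=> /(_ _ _ _)/eqP; rewrite subr_eq0 => E.
  have m3 : (2 < m - 2)%N by lia.
  rewrite -(eqP (E isT m3 (leqnn m))) q2 (qlt (m - 2)%N); last lia.
  by rewrite natrB; [ring | lia].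
Qed.
End Filiform.

(** * The family [g3n1] *)

(* [g3n1] in the weight basis [e_1, e_n, e_2, e_3, ..., e_(n-1)]. *)
Definition g3w (a b : nat) : int :=
  if a == 1%N then (if (2 < b)%N then 1 else 0)
  else if a == 2%N then -1 else if a == 3%N then 1 else 0.

(* The truncated subtractions make the first coefficients vanish: [h3w 2 3 = 0]
   and [h3w 3 4 = 0]. *)
Definition h3w (a b : nat) : int :=
  if a == 1%N then (if b == 2%N then 2 else 0)
  else if a == 2%N then - 2 * (b - 4)%N%:Z
  else if a == 3%N then 3 * (b - 5)%N%:Z
  else if a == 4%N then -3 else 0.

(** Index [i] stands for [e_(i+1)]: thus [n] is [x], [0] is [e_1], [n.-1] is [e_n] of weight 2, and
    the other [e_k] have weight [k + 1]. *)
Definition wt3 (n i : nat) : nat :=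
  (if i == n then 0 else if i == 0 then 1 else if i == n.-1 then 2 else i + 2)%N.
Definition label3 (n a : nat) : nat :=
  (if a == 0 then n else if a == 1 then 0 else if a == 2 then n.-1 else a - 2)%N.

(** Conditions free of nested conditionals come first; each is decided by [lia] if possible and
    split otherwise. *)
Ltac decide_ifs := repeat (
  match goal with |- context [if ?b then _ else _] =>
    lazymatch b with context [if _ then _ else _] => fail | _ => idtac end;
    first [ rewrite (_ : b = true); [|lia] | rewrite (_ : b = false); [|lia]
          | case: (boolP b) => ? ]
  end; cbn beta iota delta [fst snd]).

Lemma sconst3_1 n b : (2 < b < n)%N -> sconst n g3w 1 b = 1.
Proof. by move=> bn; rewrite sconstE /g3w /=; decide_ifs; lia. Qed.

Lemma sconst3_12 n : sconst n g3w 1 2 = 0.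
Proof. by rewrite /sconst; case: ifP. Qed.

Lemma sconst3_2 n b : (2 < b)%N -> (b + 2 <= n)%N -> sconst n g3w 2 b = -1.
Proof. by move=> ? ?; rewrite sconstE // addnC. Qed.

Lemma sconst3_3 n b : (3 < b)%N -> (b + 3 <= n)%N -> sconst n g3w 3 b = 1.
Proof. by move=> ? ?; rewrite sconstE // addnC. Qed.

Lemma table3E n i j k : (6 < n)%N -> (i < j)%N -> (j <= n)%N -> (k <= n)%N ->
  (if k.+1 == (ext n (g3n1 n) (w3n1 n) i.+1 j.+1).2
   then (ext n (g3n1 n) (w3n1 n) i.+1 j.+1).1 else 0)
    = if wt3 n k == (wt3 n i + wt3 n j)%N then sconst n g3w (wt3 n i) (wt3 n j) else 0.
Proof.
move=> n7 ij jn kn; rewrite /ext /w3n1 /g3n1 /sconst /asym /g3w /wt3.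
by decide_ifs; lia.
Qed.

(** The rows of [g3w] from weight 4 on are zero, so that splitting off the small weights leaves
    finitely many cases of linear arithmetic. The same works for [h3J], where the rows of [h3w]
    vanish from weight 5 on. *)
Lemma g3J n a b d : (0 < a)%N -> (a < b)%N -> (b < d)%N -> (a + b + d <= n)%N ->
  jac (sconst n g3w) (sconst n g3w) a b d = 0.
Proof.
move=> a0 ab bd abd; rewrite /jac /sconst /asym /g3w.
case: a => [|[|[|[|a]]]] in a0 ab abd *;
  case: b => [|[|[|[|b]]]] in ab bd abd *; try lia; decide_ifs; lia.
Qed.

Lemma h3J n a b d : (0 < a)%N -> (a < b)%N -> (b < d)%N -> (a + b + d <= n)%N ->
  jac (sconst n g3w) (cconst h3w) a b d = 0.
Proof.
move=> a0 ab bd abd; rewrite /jac /sconst /cconst /asym /g3w /h3w.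
case: a => [|[|[|[|[|a]]]]] in a0 ab abd *;
  case: b => [|[|[|[|[|b]]]]] in ab bd abd *; try lia; decide_ifs; lia.
Qed.

Section G3.
Variables (F : numFieldType) (n : nat).
Hypothesis n_ge7 : (7 <= n)%N.
Let lF a b : F := (sconst n g3w a b)%:~R.

(** One pair for each value [p k] with [2 <= k <= n]: [(2, 3)] for [p 2], [(3, 4)] for [p 3], and
    [(1, k - 1)] beyond. The value [p 1] stays free, by the grading derivation. *)
Definition gauge3 (a b : nat) : Prop :=
  a = 1%N /\ (3 <= b <= n - 1)%N \/ a = 2%N /\ b = 3%N \/ a = 3%N /\ b = 4%N.

Lemma g3_norm (c : nat -> nat -> F) : exists p : nat -> F, forall a b, gauge3 a b ->
  c a b = (g3w a b)%:~R * (p a + p b - p (a + b)%N).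
Proof.
(* With [p 1 = 0], the constant in [r] solves [p 3 + p 4 - p 7 = c 3 4]; the value at 2 solves
   [p 2 + p 3 - p 5 = - c 2 3], the sign being that of [g3w 2 3]. *)
pose r k := c 3%N 4%N - c 1%N 4%N - c 1%N 5%N - c 1%N 6%N - \sum_(3 <= i < k) c 1%N i.
pose p k := if k == 1%N then 0 else
  if k == 2%N then - c 1%N 3%N - c 1%N 4%N - c 2%N 3%N else r k.
have rS k : (3 <= k)%N -> r k.+1 = r k - c 1%N k.
  by move=> k3; rewrite /r big_nat_recr //= opprD addrA.
have pS k : (3 <= k)%N -> p k.+1 = p k - c 1%N k.
  by case: k => [|[|[|k]]] // k3; rewrite /p /= rS.
exists p => a b [[-> bn]|[[-> ->]|[-> ->]]].
- have [b2 p1] : (2 < b)%N /\ p 1%N = 0 by split=> //; lia.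
  by rewrite /g3w /= b2 add1n (pS b b2) p1; ring.
- rewrite /g3w /= (pS 4%N) // (pS 3%N) // (_ : p 2%N = - c 1%N 3%N - c 1%N 4%N - c 2%N 3%N) //.
  by ring.
- have r3 : p 3%N = c 3%N 4%N - c 1%N 4%N - c 1%N 5%N - c 1%N 6%N.
    by rewrite /p /= /r big_geq // subr0.
  by rewrite /g3w /= (pS 6%N) // (pS 5%N) // (pS 4%N) // (pS 3%N) // r3; ring.
Qed.

(** Two ways of reaching weight 5 give [q 2], two ways of reaching weight 7 give [q 3], and steps by
    weight 1 give the rest. *)
Lemma g3_diag_der (q : nat -> F) :
  (forall a b, (0 < a)%N -> (a < b)%N -> (a + b <= n)%N ->
     (g3w a b)%:~R * (q a + q b - q (a + b)%N) = 0) ->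
  forall a, (0 < a <= n)%N -> q a = a%:R * q 1%N.
Proof.
move=> qE.
have add a b : (0 < a)%N -> (a < b)%N -> (a + b <= n)%N -> g3w a b != 0 ->
    q (a + b)%N = q a + q b.
  move=> a0 ab abn g0; have /eqP := qE a b a0 ab abn.
  by rewrite mulf_eq0 intr_eq0 (negPf g0) subr_eq0 => /eqP.
have q1 k : (3 <= k < n)%N -> q k.+1 = q 1%N + q k.
  move=> kn; rewrite -[k.+1]add1n add //; try lia.
  by rewrite /g3w /= (_ : (2 < k)%N); last lia.
have q2 : q 2%N = 2%:R * q 1%N.
  have E : q 5%N = q 2%N + q 3%N by apply: (add 2%N 3%N) => //; lia.
  apply: (addIr (q 3%N)); rewrite -E (q1 4%N) ?(q1 3%N); [ring | lia..].
have q3 : q 3%N = 3%:R * q 1%N.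
  have E : q 7%N = q 3%N + q 4%N by apply: (add 3%N 4%N).
  have q4 : q 4%N = q 1%N + q 3%N by apply: q1; lia.
  apply: (addIr (q 4%N)); rewrite -E (q1 6%N) ?(q1 5%N) ?(q1 4%N) ?q4; [ring | lia..].
elim=> // k IH kn; have [k0|k0] := eqVneq k 0%N; first by rewrite k0 mul1r.
have [->|k1] := eqVneq k 1%N; first exact: q2.
have [->|k2] := eqVneq k 2%N; first exact: q3.
by rewrite q1 ?IH -?[k.+1]addn1 ?natrD; [ring | lia..].
Qed.

(** Rows are cleared in increasing order. Row 1 is given; the identities at [(1, 2, k)] propagate
    zero along row 2; row 3 combines those at [(2, 3, k)] with the shift relation [J1]; finally [J1]
    carries zero from each row to the next. *)
Lemma g3_uniq (c : nat -> nat -> F) : cocycle0 n lF c -> (forall a b, gauge3 a b -> c a b = 0) ->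
  c 1%N 2%N = 0 -> forall a b, (0 < a)%N -> (a < b)%N -> (a + b <= n)%N -> c a b = 0.
Proof.
move=> [c_anti cJ] cS c12.
have c1 k : (1 < k)%N -> (k < n)%N -> c 1%N k = 0.
  move=> k1 kn; have [->//|k2] := eqVneq k 2; apply: cS; left; split=> //; lia.
have c23 : c 2%N 3%N = 0 by apply: cS; right; left.
have c34 : c 3%N 4%N = 0 by apply: cS; right; right.
have c1r k : (1 < k)%N -> (k < n)%N -> c k 1%N = 0.
  by move=> k1 kn; rewrite c_anti c1 ?oppr0.
have J1 j k : (2 < j)%N -> (2 < k)%N -> (j + k + 1 <= n)%N ->
    c j k = c j.+1 k + c j k.+1.
  move=> j2 k2 jkn; have := cJ 1%N j k; rewrite /jac /lF !sconst3_1; try lia.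
  rewrite !add1n (c1 j) ?(c1 k) ?(c1r (j + k)%N) ?(c_anti j k.+1); try lia.
  by move=> E; apply/eqP; rewrite -subr_eq0 -[X in _ == X]E; [apply/eqP; ring | lia].
have c2 k : (2 < k)%N -> (k + 2 <= n)%N -> c 2%N k = 0.
  elim: k => // k IH k2 kn; have [->//|k3] := eqVneq k 2%N.
  rewrite -[RHS]IH; try lia.
  have := cJ 1%N 2%N k; rewrite /jac /lF sconst3_12 !sconst3_1; try lia.
  rewrite !add1n c12 (c1 k) ?(c1r (2 + k)%N) ?(c_anti 2%N k.+1); try lia.
  by move=> E; apply/esym/eqP; rewrite -subr_eq0 -[X in _ == X]E; [apply/eqP; ring | lia].
have J2 k : (3 < k)%N -> (k + 5 <= n)%N -> c 5%N k = c 3%N k - c 3%N k.+2.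
  move=> k3 kn; have := cJ 2%N 3%N k; rewrite /jac /lF !sconst3_2 ?sconst3_3; try lia.
  rewrite c23 (c2 k) ?(c_anti 2%N (3 + k)%N) ?(c2 (3 + k)%N) ?(c_anti 3%N (2 + k)%N); try lia.
  by move=> E; apply/eqP; rewrite -subr_eq0 -[X in _ == X]E; [apply/eqP; ring | lia].
have c3 k : (3 < k)%N -> (k + 3 <= n)%N -> c 3%N k = 0.
  elim: k => // -[//|k] IH k3 kn.
  have [->//|k2] := eqVneq k 2%N.
  have [k_3|k_3] := eqVneq k 3%N.
    by rewrite k_3 -[RHS]c34 (J1 3%N 4%N) ?anti_diag ?add0r //; lia.
  have c3k1 : c 3%N k.+1 = 0 by apply: IH; lia.
  have E2 : c 5%N k = c 3%N k - c 3%N k.+2 by apply: J2; lia.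
  have E4 : c 4%N k = c 5%N k + c 4%N k.+1 by apply: J1; lia.
  have E3 : c 3%N k = c 4%N k + c 3%N k.+1 by apply: J1; lia.
  have E3' : c 3%N k.+1 = c 4%N k.+1 + c 3%N k.+2 by apply: J1; lia.
  (* As [c 3 k.+1 = 0], the four relations combine to [c 3 k = c 3 k - 2 c 3 k.+2]. *)
  have two_neq0 : - 2%:R != 0 :> F by rewrite oppr_eq0 pnatr_eq0.
  apply/(mulfI two_neq0); rewrite mulr0 -[RHS](subrr (c 3%N k)) {1}E3 E4 E2 c3k1.
  by rewrite -[c 4%N k.+1](addrK (c 3%N k.+2)) -E3' c3k1; ring.
have c_up a b : (a.+3 < b)%N -> (a.+3 + b <= n)%N -> c a.+3 b = 0.
  elim: a b => [|a IH] b ab abn; first by apply: c3; lia.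
  have := J1 a.+3 b; rewrite !IH; try lia.
  by rewrite addr0 => E; apply/esym/E; lia.
move=> [|[|[|a]]] b a0 ab abn //; [by apply: c1; lia|by apply: c2; lia|exact: c_up].
Qed.

Lemma dimH2_g3n1 : dimH2 (@table F n.+1 (ext n (g3n1 n) (w3n1 n))) = 1%N.
Proof.
apply: (@dimH2_table F n _ g3w h3w (wt3 n) (label3 n) gauge3 1 2) => //.
- by move=> i iN; rewrite /wt3; decide_ifs; lia.
- by move=> a an; rewrite /label3; decide_ifs; lia.
- by move=> a an; rewrite /label3 /wt3; decide_ifs; lia.
- by move=> i iN; rewrite /label3 /wt3; decide_ifs; lia.
- by move=> i j k; apply: table3E.
- exact: g3J.
- exact: h3J.
- by split=> //; lia.
- by move=> a b [[-> ?]|[[-> ->]|[-> ->]]]; split=> //; lia.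
- by move=> a b [[-> ?]|[[-> ->]|[-> ->]]] //; rewrite /h3w; decide_ifs; lia.
- exact: g3_norm.
- exact: g3_uniq.
- exact: g3_diag_der.
Qed.
End G3.

(** * The algebras of dimension 8, 10 and 12 *)

Lemma eq_from_scaled (R : idomainType) (k x y e : R) : e = 0 -> k != 0 -> k * (x - y) = e -> x = y.
Proof. by move=> -> /negPf k0 /eqP; rewrite mulf_eq0 k0 subr_eq0 => /eqP. Qed.

(** Evaluates the cocycle identity at numerical weights: the structure constants are computed, the
    arguments of [c] are put in increasing order, and the values already known are substituted. *)
Ltac cocycle_at cC c a b d :=
  have := proj2 cC a b d isT; rewrite /jac; cbv beta;
  repeat match goal with |- context [addn ?x ?y] =>
    let v := eval vm_compute in (addn x y) in change (addn x y) with v end;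
  repeat match goal with |- context [sconst ?n ?g ?x ?y] =>
    let v := eval vm_compute in (sconst n g x y) in change (sconst n g x y) with v end;
  repeat match goal with |- context [c ?x ?y] =>
    match eval vm_compute in (x == y, y < x)%N with
    | (true, _) => rewrite (anti_diag x (proj1 cC))
    | (_, true) => rewrite (proj1 cC y x)
    end end;
  repeat match goal with E : c ?x ?y = _ |- context [c ?x ?y] => rewrite E end.

(** Here [k] is the coefficient of the sought entry in the identity. The calls are ordered so that
    the other entries are zero or expressed through one parameter. *)
Ltac solve_at cC c a b d k :=
  cocycle_at cC c a b d;
  let E := fresh in intro E;
  by apply: (eq_from_scaled E (k := k)); [rewrite ?oppr_eq0 ?pnatr_eq0 ?oner_eq0 | ring].

(* The tables [h17], [h29], [h311], like [h3w] above, list the solution of the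
   cocycle identities that vanishes on the gauge, up to a scalar. *)
Definition h17 (a b : nat) : int :=
  match a, b with
  | 1, 6 | 3, 4 => 1
  | _, _ => 0
  end%N.

Lemma dimH2_g17 (F : numFieldType) : dimH2 (@table F 8 (ext 7 g17 widx)) = 1%N.
Proof.
apply: (@dimH2_filiform F 7 g17 h17) => //.
- by move=> [|[|[|[|[|[|i]]]]]].
- by move=> [|[|[|[|[|[|i]]]]]].
- by apply: all_ltn3; vm_compute.
- by apply: all_ltn3; vm_compute.
move=> c cC c1 c23 c25.
have c12 := c1 2%N isT. have c13 := c1 3%N isT. have c14 := c1 4%N isT. have c15 := c1 5%N isT.
have c16 := c1 6%N isT.
have c24 : c 2%N 4%N = 0 by solve_at cC c 1%N 2%N 3%N (-1 : F).
have c34 : c 3%N 4%N = 0 by solve_at cC c 1%N 2%N 4%N (-1 : F).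
move=> [|[|[|[|a]]]] [|[|[|[|[|[|[|b]]]]]]] // *; lia.
Qed.

Definition h29 (a b : nat) : int :=
  match a, b with
  | 1, 8 => 1
  | 2, 6 => (-24)%R
  | 2, 5 => (-12)%R
  | 3, 6 => 5
  | 3, 4 | 3, 5 => 12
  | 4, 5 => (-7)%R
  | _, _ => 0
  end%N.

Lemma dimH2_g29 (F : numFieldType) : dimH2 (@table F 10 (ext 9 g29 widx)) = 1%N.
Proof.
apply: (@dimH2_filiform F 9 g29 h29) => //.
- by move=> [|[|[|[|[|[|[|[|i]]]]]]]].
- by move=> [|[|[|[|[|[|[|[|i]]]]]]]].
- by apply: all_ltn3; vm_compute.
- by apply: all_ltn3; vm_compute.
move=> c cC c1 c23 c27.
have c12 := c1 2%N isT. have c13 := c1 3%N isT. have c14 := c1 4%N isT. have c15 := c1 5%N isT.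
have c16 := c1 6%N isT. have c17 := c1 7%N isT. have c18 := c1 8%N isT.
have c24 : c 2%N 4%N = 0 by solve_at cC c 1%N 2%N 3%N (-1 : F).
have c36 : c 3%N 6%N = 0 by solve_at cC c 1%N 2%N 6%N (-1 : F).
have c45 : c 4%N 5%N = 0 by solve_at cC c 1%N 3%N 5%N (-1 : F).
have c34 : c 3%N 4%N = 0 by solve_at cC c 2%N 3%N 4%N (1 : F).
have c25 : c 2%N 5%N = 0 by solve_at cC c 1%N 2%N 4%N (-1 : F).
have c35 : c 3%N 5%N = 0 by solve_at cC c 1%N 3%N 4%N (-1 : F).
have c26 : c 2%N 6%N = 0 by solve_at cC c 1%N 2%N 5%N (-1 : F).
move=> [|[|[|[|[|a]]]]] [|[|[|[|[|[|[|[|[|b]]]]]]]]] // *; lia.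
Qed.

Definition h311 (a b : nat) : int :=
  match a, b with
  | 1, 10 | 2, 7 => 4
  | 2, 6 => 6
  | 2, 5 => 3
  | 3, 4 | 2, 8 | 3, 5 => (-3)%R
  | 3, 6 => 2
  | 3, 7 => 7
  | 4, 7 => (-4)%R
  | 4, 5 | 4, 6 => (-5)%R
  | 5, 6 => 8
  | _, _ => 0
  end%N.

Lemma dimH2_g311 (F : numFieldType) : dimH2 (@table F 12 (ext 11 g311 widx)) = 1%N.
Proof.
apply: (@dimH2_filiform F 11 g311 h311) => //.
- by move=> [|[|[|[|[|[|[|[|[|[|i]]]]]]]]]].
- by move=> [|[|[|[|[|[|[|[|[|[|i]]]]]]]]]].
- by apply: all_ltn3; vm_compute.
- by apply: all_ltn3; vm_compute.
move=> c cC c1 c23 c29.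
have c12 := c1 2%N isT. have c13 := c1 3%N isT. have c14 := c1 4%N isT. have c15 := c1 5%N isT.
have c16 := c1 6%N isT. have c17 := c1 7%N isT. have c18 := c1 8%N isT. have c19 := c1 9%N isT.
have c110 := c1 10%N isT.
have c24 : c 2%N 4%N = 0 by solve_at cC c 1%N 2%N 3%N (-1 : F).
have c38 : c 3%N 8%N = 0 by solve_at cC c 1%N 2%N 8%N (-1 : F).
have c47 : c 4%N 7%N = 0 by solve_at cC c 1%N 3%N 7%N (-1 : F).
have c56 : c 5%N 6%N = 0 by solve_at cC c 1%N 4%N 6%N (-1 : F).
(* From here on the entries are reduced to multiples of the single unknown [c 2 5]. *)
have c34 : c 3%N 4%N = - c 2%N 5%N by solve_at cC c 1%N 2%N 4%N (-1 : F).
have c35 : c 3%N 5%N = - c 2%N 5%N by solve_at cC c 1%N 3%N 4%N (-1 : F).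
have c26 : c 2%N 6%N = 2%:R * c 2%N 5%N by solve_at cC c 1%N 2%N 5%N (-1 : F).
have c36 : c 3%N 6%N = - 2%:R * c 2%N 5%N by solve_at cC c 2%N 3%N 6%N (1 : F).
have c45 : c 4%N 5%N = c 2%N 5%N by solve_at cC c 1%N 3%N 5%N (-1 : F).
have c46 : c 4%N 6%N = c 2%N 5%N by solve_at cC c 1%N 4%N 5%N (-1 : F).
have c37 : c 3%N 7%N = - 3%:R * c 2%N 5%N by solve_at cC c 1%N 3%N 6%N (-1 : F).
have c27 : c 2%N 7%N = 4%:R * c 2%N 5%N by solve_at cC c 1%N 2%N 6%N (-1 : F).
have c28 : c 2%N 8%N = 7%:R * c 2%N 5%N by solve_at cC c 1%N 2%N 7%N (-1 : F).
(* The surviving terms are [c 2 5 + c 2 8], that is [8 * c 2 5]. *)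
have c25 : c 2%N 5%N = 0 by solve_at cC c 2%N 3%N 5%N (8%:R : F).
rewrite c25 ?mulr0 ?oppr0 in c34 c35 c26 c36 c45 c46 c37 c27 c28.
move=> [|[|[|[|[|[|a]]]]]] [|[|[|[|[|[|[|[|[|[|[|b]]]]]]]]]]] // *; lia.
Qed.

Theorem theorem3p10 :
  (forall n : nat, (7 <= n)%N -> dimH2 (R3n1 n) = 1%N) /\
  dimH2 R17 = 1%N /\ dimH2 R29 = 1%N /\ dimH2 R311 = 1%N.
Proof.
(* [C] is declared as a bare field; writing the complex numbers out again recovers their
   [numFieldType] structure. *)
split=> [n n7|]; first exact: (@dimH2_g3n1 (Rdefinitions.R[i]%C) n n7).
split; first exact: (dimH2_g17 (Rdefinitions.R[i]%C)).
split; first exact: (dimH2_g29 (Rdefinitions.R[i]%C)).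
exact: (dimH2_g311 (Rdefinitions.R[i]%C)).
Qed.
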